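(* Let $\mathbb{T}$ be a time scale, $a,b\in\mathbb{T}$ with $a<b$, and $[a,b]=\{t\in\mathbb{T}:a\le t\le b\}$. Let $y_a,y_b,l\in\mathbb{R}$. Let $L,g:[a,b]^\kappa\times\mathbb{R}\times\mathbb{R}\to\mathbb{R}$, written $(t,x,v)\mapsto L(t,x,v)$ and $(t,x,v)\mapsto g(t,x,v)$, be functions such that: $L$ and $g$ have continuous partial derivatives $L_x,L_v,g_x,g_v$ with respect to the second and third variables, for all $t\in[a,b]^\kappa$; and for every $y\in C^1_{\mathrm{rd}}$ each of the functions $t\mapsto L(t,y^\sigma(t),y^\Delta(t))$, $L_x(t,y^\sigma(t),y^\Delta(t))$, $L_v(t,y^\sigma(t),y^\Delta(t))$, $g(t,y^\sigma(t),y^\Delta(t))$, $g_x(t,y^\sigma(t),y^\Delta(t))$, $g_v(t,y^\sigma(t),y^\Delta(t))$ is rd-continuous. Define functionals on $C^1_{\mathrm{rd}}$ by $$J(y)=\int_a^b L(t,y^\sigma(t),y^\Delta(t))\,\Delta t,\qquad I(y)=\int_a^b g(t,y^\sigma(t),y^\Delta(t))\,\Delta t.$$ Suppose that $J$ has a local minimum at $y_\ast\in C^1_{\mathrm{rd}}$ subject to the boundary conditions $y(a)=y_a$, $y(b)=y_b$ and the isoperimetric constraint $I(y)=l$ (that is, a local minimum in $S=\{y\in C^1_{\mathrm{rd}}: y(a)=y_a,\ y(b)=y_b,\ I(y)=l\}$ at $y_\ast\in S$), and that $y_\ast$ is not an extremal for the functional $I$. Then there exists a constant $\lambda\in\mathbb{R}$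 such that, with $F=L-\lambda g$, $y_\ast$ satisfies $$F_v^\Delta(t,y_\ast^\sigma(t),y_\ast^\Delta(t))-F_x(t,y_\ast^\sigma(t),y_\ast^\Delta(t))=0\quad\text{for all } t\in[a,b]^{\kappa^2},$$ where $F_v^\Delta(t,y_\ast^\sigma(t),y_\ast^\Delta(t))$ denotes the delta derivative at $t$ of the composition $t\mapsto F_v(t,y_\ast^\sigma(t),y_\ast^\Delta(t))$.
   Context: A time scale $\mathbb{T}$ is a nonempty closed subset of $\mathbb{R}$. The forward jump operator is $\sigma(t)=\inf\{s\in\mathbb{T}:s>t\}$ and the backward jump operator is $\rho(t)=\sup\{s\in\mathbb{T}:s<t\}$, with $\inf\emptyset=\sup\mathbb{T}$ and $\sup\emptyset=\inf\mathbb{T}$ (so $\sigma(M)=M$ if $M=\max\mathbb{T}$, and $\rho(m)=m$ if $m=\min\mathbb{T}$). A point $t$ is right-dense, right-scattered, left-dense, left-scattered if $\sigma(t)=t$, $\sigma(t)>t$, $\rho(t)=t$, $\rho(t)<t$, respectively. The interval $[a,b]=\{t\in\mathbb{T}:a\le t\le b\}$ is itself regarded as a time scale; $[a,b]^\kappa=[a,b]\setminus(\rho(b),b]$ and $[a,b]^{\kappa^2}=([a,b]^\kappa)^\kappa$ (for a time scale with maximum $M$, the operation $\kappa$ removes $(\rho(M),M]$, where $\rho$ is computed in that time scale). A function $f$ on a time scale $\mathbb{T}$ is delta differentiable at $t\in\mathbb{T}^\kappa$ if there is a number $f^\Delta(t)$ (the delta derivative) such that for all $\varepsilon>0$ there is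 $\delta>0$ with $|f(\sigma(t))-f(s)-f^\Delta(t)(\sigma(t)-s)|\le\varepsilon|\sigma(t)-s|$ for all $s\in(t-\delta,t+\delta)\cap\mathbb{T}$. We write $f^\sigma=f\circ\sigma$. A function is rd-continuous if it is continuous at right-dense points and its left-sided limit exists at left-dense points. $C^1_{\mathrm{rd}}$ is the set of delta differentiable functions $y:[a,b]\to\mathbb{R}$ (i.e. delta differentiable at every point of $[a,b]^\kappa$) whose delta derivative is rd-continuous; it is equipped with a norm $\|\cdot\|$. Every rd-continuous function $f$ has an antiderivative $F$ (that is, $F^\Delta=f$), and the delta integral is $\int_a^b f(t)\,\Delta t=F(b)-F(a)$. Local minimum: for $S\subseteq C^1_{\mathrm{rd}}$, a functional $J:C^1_{\mathrm{rd}}\to\mathbb{R}$ has a local minimum in $S$ at $y_\ast\in S$ if there is $\delta>0$ such that $J(y_\ast)\le J(y)$ for all $y\in S$ with $\|y-y_\ast\|<\delta$. Extremal for $I$: a function $y_\ast\in C^1_{\mathrm{rd}}$ satisfying $y_\ast(a)=y_a$, $y_\ast(b)=y_b$, $I(y_\ast)=l$ is an extremal for $I$ if there is a constant $c$ such that $$g_v(t,y_\ast^\sigma(t),y_\ast^\Delta(t))-\int_a^t g_x(\tau,y_\ast^\sigma(\tau),y_\ast^\Delta(\tau))\,\Delta\tau=c\quad\text{for all }t\in[a,b]^\kappa.$$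
   Formalization: Partial derivatives of L, g are assumed continuous in (x,v) uniformly in t (the claim fails otherwise); at t=ρ(b) left-dense with b left-scattered, where F_v at σ(t)=b is undefined, the delta derivative is that of some extension of the composition to b. *)

(* Defs.v *)
From HB Require Import structures.
From mathcomp Require Import all_boot all_order all_algebra.
From mathcomp Require Import all_classical all_reals all_analysis.
Set Implicit Arguments.
Unset Strict Implicit.
Unset Printing Implicit Defensive.
Import Order.TTheory GRing.Theory Num.Theory.
Import numFieldNormedType.Exports.
Local Open Scope classical_set_scope.
Local Open Scope ring_scope.

(* A function on a subset of R is represented by a total function R -> R whose
   values outside that subset are irrelevant. *)

Section TimeScales.
Context {R : realType}.
Implicit Types (T D : set R) (f y : R -> R) (L g : R -> R -> R -> R).

Definition time_scale T := T !=set0 /\ closed T.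

(* [inf set0 = sup set0 = 0] in the library, hence the case distinctions
   implementing inf 0 = sup T and sup 0 = inf T. *)
Definition sigma T (t : R) : R :=
  if `[< exists s, T s /\ t < s >] then inf [set s | T s /\ t < s] else sup T.

Definition rho T (t : R) : R :=
  if `[< exists s, T s /\ s < t >] then sup [set s | T s /\ s < t] else inf T.

Definition ts_interval T (a b : R) : set R := [set t | T t /\ a <= t <= b].

Definition kappa T : set R :=
  [set t | T t /\
     forall M, T M -> (forall s, T s -> s <= M) -> ~ (rho T M < t <= M)].

Definition has_delta_deriv T f (t d : R) : Prop :=
  forall e : R, 0 < e -> exists2 delta : R, 0 < delta &
    forall s, T s -> `|s - t| < delta ->
      `|f (sigma T t) - f s - d * (sigma T t - s)| <= e * `|sigma T t - s|.

Definition delta_differentiable T f (t : R) := exists d, has_delta_deriv T f t d.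

(* Meaningful where [f] is delta differentiable and its derivative is unique. *)
Definition delta_deriv T f (t : R) : R := get [set d | has_delta_deriv T f t d].

(* Delta derivative at [t], with respect to [T], of a function that is only
   given on [D]: that of some function on [T] extending it.
   For D = kappa T this is the usual derivative whenever sigma T t lies in D
   (see [has_delta_deriv_on_kappa]). The exception is t = rho T M, where
   M = max T is left-scattered and t is left-dense: there sigma T t = M is
   outside D, although t lies in kappa (kappa T). *)
Definition has_delta_deriv_on T D f (t d : R) : Prop :=
  exists h : R -> R, (forall s, D s -> h s = f s) /\ has_delta_deriv T h t d.

(* [f] is a function on [D] (D is T or kappa T); the points are classified in [T].
   When t is isolated from the left in D the left limit condition is void. *)
Definition rd_continuous T D f : Prop :=
  forall t, D t ->
    (sigma T t = t -> f s @[s --> within D (nbhs t)] --> f t) /\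
    (rho T t = t -> exists l : R, f s @[s --> within D (t^'-)] --> l).

Definition C1rd T y : Prop :=
  (forall t, kappa T t -> delta_differentiable T y t) /\
  rd_continuous T (kappa T) (delta_deriv T y).

Definition antiderivative T f (F : R -> R) : Prop :=
  forall t, kappa T t -> has_delta_deriv T F t (f t).

(* Integral over [r, s] of a function given on kappa T. *)
Definition delta_integral T f (r s : R) : R :=
  get [set v | exists2 F, antiderivative T f F & v = F s - F r].

(* A norm on the space C1rd T, two functions that agree on [T] being the same
   vector of that space. *)
Definition is_C1rd_norm T (N : (R -> R) -> R) : Prop :=
  [/\ (forall y, C1rd T y -> 0 <= N y),
      (forall y, C1rd T y -> (N y = 0 <-> forall t, T t -> y t = 0)),
      (forall (c : R) y, C1rd T y -> N (fun t => c * y t) = `|c| * N y) &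
      (forall y z, C1rd T y -> C1rd T z ->
         N (fun t => y t + z t) <= N y + N z)].

Definition local_minimum (N : (R -> R) -> R) (S : set (R -> R))
    (J : (R -> R) -> R) (ystar : R -> R) : Prop :=
  S ystar /\
  exists2 delta : R, 0 < delta &
    forall y, S y -> N (fun t => y t - ystar t) < delta -> J ystar <= J y.

Definition partial_x L (t x v : R) : R := derive1 (fun x' => L t x' v) x.
Definition partial_v L (t x v : R) : R := derive1 (fun v' => L t x v') v.

Definition along T L y (t : R) : R := L t (y (sigma T t)) (delta_deriv T y t).

(* The partial derivatives are continuous in (x, v), uniformly in t. Joint
   continuity in (t, x, v) on kappa T implies this when kappa T is compact (see
   [joint_continuous_equicontinuous]), but would exclude coefficients that are
   only rd-continuous in t. *)
Definition continuous_partials T L : Prop :=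
  [/\ (forall t x v, kappa T t -> derivable (fun x' => L t x' v) x 1),
      (forall t x v, kappa T t -> derivable (fun v' => L t x v') v 1),
      equicontinuous (kappa T)
        (fun (t : R) (p : R * R) => partial_x L t p.1 p.2) &
      equicontinuous (kappa T)
        (fun (t : R) (p : R * R) => partial_v L t p.1 p.2)].

Definition lagrangian T L : Prop :=
  continuous_partials T L /\
  forall y, C1rd T y ->
    [/\ rd_continuous T (kappa T) (along T L y),
        rd_continuous T (kappa T) (along T (partial_x L) y) &
        rd_continuous T (kappa T) (along T (partial_v L) y)].

Definition functional T L (a b : R) (y : R -> R) : R :=
  delta_integral T (along T L y) a b.

Definition extremal T g (a b ya yb l : R) (ystar : R -> R) : Prop :=
  [/\ C1rd T ystar, ystar a = ya, ystar b = yb,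
      functional T g a b ystar = l &
      exists c : R, forall t, kappa T t ->
        along T (partial_v g) ystar t
        - delta_integral T (along T (partial_x g) ystar) a t = c].

End TimeScales.
Lemma has_delta_deriv_on_kappa (R : realType) (T : set R) (f : R -> R) (t d : R) :
  kappa T t -> kappa T (sigma T t) ->
  has_delta_deriv_on T (kappa T) f t d <-> has_delta_deriv T f t d.
Proof.
move=> kt kst; split; last by exists f.
case=> h [hf hd].
have [r r0 rP] : exists2 r : R, 0 < r &
    forall s, T s -> `|s - t| < r -> kappa T s.
  have [[M [TM Mmax Mscat]]|noM] := pselect (exists M, [/\ T M,
    (forall s, T s -> s <= M) & rho T M < M]); last first.
    exists 1 => // s Ts _; split=> // M TM Mmax /andP[rs sM].
    by apply: noM; exists M; split=> //; exact: lt_le_trans rs sM.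
  have tM : t < M.
    have [Tt /(_ M TM Mmax) /negP] := kt.
    rewrite (Mmax _ Tt) andbT -leNgt => trho.
    exact: le_lt_trans trho Mscat.
  exists (M - t); first by rewrite subr_gt0.
  move=> s Ts st; split=> // M' TM' M'max.
  have -> : M' = M by apply/le_anti; rewrite Mmax// M'max.
  move=> /andP[rs _].
  have sM : s < M.
    by rewrite -(ltrD2r (- t)); apply: le_lt_trans st; exact: ler_norm.
  suff : s <= rho T M by rewrite leNgt rs.
  rewrite /rho; case: asboolP => [ex|]; last by case; exists s.
  apply: ub_le_sup; last by split.
  by exists M => u [_ /ltW].
move=> e e0; have [de de0 deP] := hd e e0.
exists (Num.min de r); first by rewrite lt_min de0.
move=> s Ts; rewrite lt_min => /andP[sde sr].
by rewrite -(hf _ kst) -(hf _ (rP _ Ts sr)); exact: deP.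
Qed.

Lemma joint_continuous_equicontinuous (R : realType) (K : set R)
    (f : R -> R * R -> R) :
  compact K ->
  {within K `*` setT, continuous (fun q : R * (R * R) => f q.1 q.2)} ->
  equicontinuous K (fun t p => f t p).
Proof.
move=> /compact_near_coveringP cK cf p E entE.
suff : \forall p' \near nbhs p, K `<=` (fun t => K t -> E (f t p, f t p')).
  by apply: filterS => p' H t Kt; exact: H.
apply: cK => t Kt.
have eV : entourage (split_ent E `&` (split_ent E)^-1%relation : set (R * R)).
  by apply: filterI => //; exact: entourage_inv.
have /cvg_entourageP /(_ _ eV) :=
  (subspace_continuousP _ _).1 cf (t, p) (conj Kt I).
rewrite /= !near_simpl /prop_near1 /within/=.
move=> [] [A B] /= [nA nB] sAB.
exists (A, B); first by split.
move=> [s p'] /= [As Bp'] Ks.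
have [V1 _] := sAB (s, p') (conj As Bp') (conj Ks I).
have [_ V2] := sAB (s, p) (conj As (nbhs_singleton nB)) (conj Ks I).
exact: (entourage_split (f t p)) entE V2 V1.
Qed.

(* Main.v *)
Require Import Defs.
From mathcomp Require Import all_boot all_order all_algebra.
From mathcomp Require Import all_classical all_reals all_analysis.
From mathcomp Require Import ring lra.
Local Open Scope classical_set_scope.
Local Open Scope ring_scope.
Set Implicit Arguments.
Unset Strict Implicit.
Unset Printing Implicit Defensive.
Import Order.TTheory GRing.Theory Num.Theory.
Import numFieldNormedType.Exports.

(** Write X for the compact scale [a, b], y for the minimizer, and let A_L, A_g
    be delta antiderivatives of L_x and g_x along y.  For a variation h that
    vanishes at a and b the product rule gives
      int (L_x h^sigma + L_v h^Delta) = int q_L h^Delta,   q_L = L_v - A_L,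
    and likewise for g, so both first variations are integrals against h^Delta
    ([functional_increment]).  Since h^Delta can be any rd-continuous function
    of mean zero, only the mean-free parts p_L, p_g of q_L, q_g matter.

    If y is not an extremal for I then q_g is not constant, so p_g <> 0.  Let
    r = p_L - lambda p_g be the part of p_L orthogonal to p_g for the inner
    product int f h.  Take w with w^Delta = - r and eta with eta^Delta = p_g.
    Along w the functional I is stationary while J has slope - int r^2; along
    eta, I has slope int p_g^2 > 0.  If int r^2 were positive, moving along w
    and correcting with a much smaller multiple of eta would restore I = l and
    still decrease J ([constrained_descent]; the intermediate value theorem
    takes the place of the implicit function theorem).  The competitors stay
    in one plane, on which every norm is controlled by the two coordinates, so
    they come arbitrarily close to y, contradicting local minimality.  Hence
    r = 0, that is, L_v - lambda g_v equals A_L - lambda A_g plus a constant on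
    X^kappa ([isoperimetric_du_bois_reymond]), and the right-hand side has delta
    derivative L_x - lambda g_x.

    The calculus behind this is built from two facts.  A function with
    nonnegative delta derivative is nondecreasing
    ([antiderivative_nondecreasing]), which yields uniqueness of integrals,
    their monotonicity and the vanishing of f when int f^2 = 0.  And every
    rd-continuous f has an antiderivative ([rd_continuous_antiderivative]),
    obtained as the largest function whose increments are bounded by upper
    bounds of f. *)

(** * Functions of real variables *)

Lemma closed_adherent (R : realType) (X : set R) (t : R) :
  closed X -> (forall e, 0 < e -> exists2 s, X s & `|s - t| < e) -> X t.
Proof.
move=> clX H; apply: clX => B /nbhs_ballP[e /= e0 eB].
have [s Xs st] := H e e0.
by exists s; split=> //; apply: eB; rewrite /ball/= distrC.
Qed.

Lemma mean_value_increment (R : realType) (f : R -> R) (x p : R) :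
  (forall z, derivable f z 1) ->
  exists2 z, `|z - x| <= `|p| & f (x + p) - f x = derive1 f z * p.
Proof.
move=> df.
have cf : continuous f.
  by move=> z; apply/differentiable_continuous/derivable1_diffP.
have isd (z : R) : is_derive z (1 : R) f (derive1 f z).
  by rewrite derive1E; apply/derivableP.
have [p0|p0] := leP 0 p.
  have xp : x <= x + p by rewrite lerDl.
  have [z + Ez] := MVT_segment xp (fun z _ => isd z) (continuous_subspaceT cf).
  rewrite in_itv /= => /andP[h1 h2]; exists z; last by rewrite Ez; ring.
  by rewrite [`|p|]ger0_norm// ler_norml; apply/andP; split; lra.
have xp : x + p <= x by lra.
have [z + Ez] := MVT_segment xp (fun z _ => isd z) (continuous_subspaceT cf).
rewrite in_itv /= => /andP[h1 h2]; exists z.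
  by rewrite [`|p|]ltr0_norm// ler_norml; apply/andP; split; lra.
have -> : f (x + p) - f x = - (f x - f (x + p)) by ring.
by rewrite Ez; ring.
Qed.

(** Compactness of the box upgrades equicontinuity at each point to a modulus
    that depends neither on the point of the box nor on the index t. *)
Lemma equicontinuous_uniform_on_box (R : realType) (W : set R)
    (f : R -> R * R -> R) (M e : R) :
  equicontinuous W f -> 0 < e -> exists2 de : R, 0 < de &
    forall t x v x' v', W t -> `|x| <= M -> `|v| <= M ->
      `|x' - x| < de -> `|v' - v| < de -> `|f t (x, v) - f t (x', v')| <= e.
Proof.
move=> fW e0.
have /compact_near_coveringP cov :
  compact (`[- M, M]%classic `*` `[- M, M]%classic : set (R * R)).
  by apply: compact_setX; exact: segment_compact.
have := cov R (0 : R)^'+ (fun de p => forall t p', W t -> `|p'.1 - p.1| < de ->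
  `|p'.2 - p.2| < de -> `|f t p - f t p'| <= e) _.
case=> [p _|de0 /= de00 H].
  have e2 : 0 < e / 2 by lra.
  have := fW p _ (entourage_ball R (PosNum e2)).
  move=> /nbhs_ballP[r /= r0 Hr].
  have Hr' t p' : W t -> `|p'.1 - p.1| < r -> `|p'.2 - p.2| < r ->
      `|f t p - f t p'| < e / 2.
    move=> Wt h1 h2; apply: (Hr p') => //.
    by split; rewrite /ball/= distrC.
  have r2 : 0 < r / 2 by lra.
  exists (ball p (r / 2), [set d | d < r / 2]).
    split; first exact: nbhsx_ballx.
    exact: nbhs_right_lt.
  move=> [q d] /= [[q1 q2] dr] t p' Wt h1 h2.
  rewrite /ball/= in q1 q2.
  have -> : f t q - f t p' = (f t p - f t p') - (f t p - f t q) by ring.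
  have E1 : `|f t p - f t q| < e / 2.
    by apply: Hr' => //; rewrite distrC; lra.
  have E2 : `|f t p - f t p'| < e / 2.
    apply: Hr' => //.
      have -> : p'.1 - p.1 = (p'.1 - q.1) - (p.1 - q.1) by ring.
      by apply: le_lt_trans (ler_normB _ _) _; lra.
    have -> : p'.2 - p.2 = (p'.2 - q.2) - (p.2 - q.2) by ring.
    by apply: le_lt_trans (ler_normB _ _) _; lra.
  by apply: le_trans (ler_normB _ _) _; lra.
have d2 : 0 < de0 / 2 by lra.
exists (de0 / 2) => // t x v x' v' Wt xM vM xx vv.
have := H (de0 / 2) _ d2 (x, v) _ t (x', v') Wt xx vv; apply.
  by rewrite /ball_ /= sub0r normrN gtr0_norm//; lra.
by split; rewrite /= in_itv /= -ler_norml.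
Qed.

(** Frechet differentiability at the origin of the plane, with gradient
    (A, B). *)
Definition expands_at0 (R : realType) (phi : R -> R -> R) (A B : R) : Prop :=
  forall e : R, 0 < e -> exists2 de : R, 0 < de &
    forall s r, `|s| < de -> `|r| < de ->
      `|phi s r - phi 0 0 - (s * A + r * B)| <= e * (`|s| + `|r|).

(** Lagrange multipliers in the plane.  For small s > 0 the values of psi(s, .)
    at - k s and k s lie on the two sides of psi(0, 0), because the slope C
    outweighs the error term; a zero r of psi(s, .) - psi(0, 0) in between
    satisfies |r| <= k s, and k is small enough for the gain s A in phi to
    absorb r B. *)
Lemma constrained_descent (R : realType) (phi psi : R -> R -> R)
    (A B C de : R) :
  expands_at0 phi A B -> expands_at0 psi 0 C ->
  (forall s, continuous (psi s)) -> A < 0 -> 0 < C -> 0 < de ->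
  exists s r, [/\ `|s| < de, `|r| < de, psi s r = psi 0 0 & phi s r < phi 0 0].
Proof.
move=> Dphi Dpsi cpsi A0 C0 de0.
have B0 := normr_ge0 B.
(* With this k, the term r B costs at most a quarter of the gain - A s. *)
pose k : R := - A / (4 * (`|B| + 1)).
have k0 : 0 < k by rewrite divr_gt0//; lra.
have kB : k * `|B| <= - A / 4.
  have -> : - A / 4 = k * (`|B| + 1) by rewrite /k; field; lra.
  by rewrite ler_pM2l//; lra.
(* For |r| <= k s the error terms are then at most a quarter of the gain in
   phi, and half of the change k s C in psi. *)
have e10 : 0 < - A / (4 * (1 + k)) by rewrite divr_gt0//; lra.
have e20 : 0 < k * C / (2 * (1 + k)) by rewrite divr_gt0 ?mulr_gt0//; lra.
have [d1 d10 H1] := Dphi _ e10; have [d2 d20 H2] := Dpsi _ e20.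
pose d : R := Num.min de (Num.min d1 d2).
have d0 : 0 < d by rewrite !lt_min de0 d10.
pose s : R := d / (2 * (1 + k)).
have s0 : 0 < s by rewrite divr_gt0//; lra.
have sE : s + k * s = d / 2 by rewrite /s; field; lra.
have ks0 : 0 < k * s by rewrite mulr_gt0.
have dle : [/\ d <= de, d <= d1 & d <= d2].
  by rewrite /d !ge_min !lexx ?orbT.
have [dde dd1 dd2] := dle.
have bnd (r : R) : `|r| <= k * s -> [/\ `|s| < d & `|r| < d].
  by move=> rk; rewrite gtr0_norm//; split; lra.
have psi_bnd r : `|r| <= k * s -> `|psi s r - psi 0 0 - r * C| <= k * C / 2 * s.
  move=> rk; have [sd rd] := bnd r rk.
  have := H2 s r (lt_le_trans sd dd2) (lt_le_trans rd dd2).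
  rewrite mulr0 add0r [`|s|]gtr0_norm// => /le_trans; apply.
  have -> : k * C / 2 * s = k * C / (2 * (1 + k)) * (s + k * s) by field; lra.
  by rewrite ler_pM2l//; lra.
have kC : 0 < k * C * s by apply: mulr_gt0 => //; exact: mulr_gt0.
have hp : psi 0 0 <= psi s (k * s).
  have := psi_bnd (k * s); rewrite gtr0_norm// lexx => /(_ isT).
  by rewrite ler_norml => /andP[+ _]; nra.
have hm : psi s (- (k * s)) <= psi 0 0.
  have := psi_bnd (- (k * s)); rewrite normrN gtr0_norm// lexx => /(_ isT).
  by rewrite ler_norml => /andP[_]; nra.
have ks2 : - (k * s) <= k * s by lra.
have [r rk Er] : exists2 r, r \in `[- (k * s), k * s] & psi s r = psi 0 0.
  apply: IVT => //; first exact: continuous_subspaceT.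
  by rewrite ge_min hm le_max hp orbT.
have rks : `|r| <= k * s by move: rk; rewrite in_itv /= -ler_norml.
have [sd rd] := bnd r rks.
exists s, r; split=> //; [exact: lt_le_trans sd dde|exact: lt_le_trans rd dde|].
have := H1 s r (lt_le_trans sd dd1) (lt_le_trans rd dd1).
rewrite [`|s|]gtr0_norm// => h.
have h1 : - A / (4 * (1 + k)) * (s + `|r|) <= - A / 4 * s.
  have -> : - A / 4 * s = - A / (4 * (1 + k)) * (s + k * s) by field; lra.
  by rewrite ler_pM2l//; lra.
have h2 : r * B <= - A / 4 * s.
  apply: le_trans (ler_norm _) _; rewrite normrM.
  apply: (@le_trans _ _ (k * s * `|B|)); first by rewrite ler_wpM2r.
  have -> : k * s * `|B| = k * `|B| * s by ring.
  by rewrite ler_wpM2r// ltW.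
have h3 : A * s < 0 by rewrite nmulr_rlt0.
move: h; rewrite ler_norml => /andP[_ h]; nra.
Qed.

(** * Jump operators of a compact time scale *)

Definition compact_scale (R : realType) (X : set R) (a b : R) : Prop :=
  [/\ closed X, X a, X b, a < b & forall t, X t -> a <= t <= b].

Section CompactScale.
Context (R : realType) (X : set R) (a b : R).
Hypothesis cX : compact_scale X a b.
Implicit Types (f y h F G : R -> R) (s t d : R).

Let clX : closed X. Proof. by case: cX. Qed.
Let Xa : X a. Proof. by case: cX. Qed.
Let Xb : X b. Proof. by case: cX. Qed.
Let ab : a < b. Proof. by case: cX. Qed.
Let Xge t : X t -> a <= t. Proof. by case: cX => _ _ _ _ H /H /andP[]. Qed.
Let Xle t : X t -> t <= b. Proof. by case: cX => _ _ _ _ H /H /andP[]. Qed.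

Lemma sigma_max : sigma X b = b.
Proof.
rewrite /sigma; case: asboolP => [[s [Xs]]|_].
  by rewrite ltNge Xle.
apply/le_anti/andP; split.
  by apply: ge_sup; [exists b|move=> s /Xle].
by apply: ub_le_sup => //; exists b => s /Xle.
Qed.

Lemma sigma_next t : X t -> t < b ->
  [/\ X (sigma X t), t <= sigma X t &
      forall s, X s -> t < s -> sigma X t <= s].
Proof.
move=> Xt tb; rewrite /sigma; case: asboolP => [_|]; last by case; exists b.
set E := [set s | X s /\ t < s].
have Eb : E b by [].
have lE : has_lbound E by exists t => s [_ /ltW].
have iE : has_inf E by split=> //; exists b.
split.
- apply: closed_adherent => // e e0.
  have [s [Xs ts] si] := inf_adherent e0 iE.
  exists s => //; rewrite ger0_norm ?subr_ge0; first by rewrite ltrBlDl.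
  by apply: ge_inf.
- by apply: lb_le_inf; [exists b|move=> s [_ /ltW]].
- by move=> s Xs ts; apply: ge_inf.
Qed.

Lemma sigma_in t : X t -> X (sigma X t).
Proof.
move=> Xt; have [tb|bt] := ltP t b; first by case: (sigma_next Xt tb).
by have -> : t = b; [apply/le_anti; rewrite Xle|rewrite sigma_max].
Qed.

Lemma sigma_ge t : X t -> t <= sigma X t.
Proof.
move=> Xt; have [tb|bt] := ltP t b; first by case: (sigma_next Xt tb).
by have -> : t = b; [apply/le_anti; rewrite Xle|rewrite sigma_max].
Qed.

Lemma lt_sigma t s : X t -> X s -> t < s -> sigma X t <= s.
Proof.
move=> Xt Xs ts; case: (@sigma_next t) => //; first exact: lt_le_trans (Xle Xs).
by move=> _ _; apply.
Qed.

(** At t = b this fails: sigma b = b holds by convention. *)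
Lemma right_dense_adherent t e : X t -> t < b -> sigma X t = t -> 0 < e ->
  exists s, [/\ X s, t < s & s < t + e].
Proof.
move=> Xt tb; rewrite {1}/sigma; case: asboolP => [_|]; last by case; exists b.
move=> st e0.
have iE : has_inf [set s | X s /\ t < s].
  by split; [exists b|exists t => s [_ /ltW]].
by have [s [Xs ts]] := inf_adherent e0 iE; rewrite st; exists s.
Qed.

Lemma left_dense_adherent t e : X t -> a < t -> rho X t = t -> 0 < e ->
  exists s, [/\ X s, s < t & t - e < s].
Proof.
move=> Xt ta; rewrite {1}/rho; case: asboolP => [_|]; last by case; exists a.
move=> st e0.
have iE : has_sup [set s | X s /\ s < t].
  by split; [exists a|exists t => s [_ /ltW]].
by have [s [Xs ts]] := sup_adherent e0 iE; rewrite st; exists s.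
Qed.

Lemma rho_prev t s : X s -> s < t -> s <= rho X t <= t.
Proof.
move=> Xs st; rewrite /rho; case: asboolP => [_|]; last by case; exists s.
apply/andP; split.
  by apply: ub_le_sup; [exists t => u [_ /ltW]|].
by apply: ge_sup; [exists s|move=> u [_ /ltW]].
Qed.

Lemma rho_le t : X t -> rho X t <= t.
Proof.
move=> Xt; have [ta|at_] := ltP a t; first by have /andP[] := rho_prev Xa ta.
rewrite /rho; case: asboolP => [[s [Xs st]]|_].
  by have := Xge Xs; rewrite leNgt (lt_le_trans st at_).
by apply: ge_inf => //; exists a => s /Xge.
Qed.

Lemma kappa_sub t : kappa X t -> X t. Proof. by case. Qed.

Lemma kappa_lt t : X t -> t < b -> kappa X t.
Proof.
move=> Xt tb; split=> // M XM Mmax.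
have -> : M = b by apply/le_anti; rewrite Xle// Mmax.
move=> /andP[+ _]; have /andP[+ _] := rho_prev Xt tb.
by move=> /le_lt_trans h /h; rewrite ltxx.
Qed.

Lemma kappa_left_dense : rho X b = b -> kappa X b.
Proof.
move=> rb; split=> // M XM Mmax.
have -> : M = b by apply/le_anti; rewrite Xle// Mmax.
by rewrite rb ltxx.
Qed.

(** The maximum belongs to the truncated scale exactly when it is left-dense;
    this is what makes delta derivatives unique there. *)
Lemma kappaP t : kappa X t -> t < b \/ t = b /\ rho X b = b.
Proof.
move=> kt; have Xt := kappa_sub kt; have [tb|bt] := ltP t b; [by left|right].
have tb : t = b by apply/le_anti; rewrite Xle.
split=> //; case: kt => _ /(_ b Xb (fun s => @Xle s)).
rewrite tb lexx andbT => /negP.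
by rewrite -leNgt => h; apply/le_anti; rewrite h rho_le.
Qed.

(** * Delta derivatives *)

(** Applying the definition both at s and at t itself bounds the difference of
    the two increments from sigma t. *)
Lemma has_delta_deriv_continuous f t d : X t -> has_delta_deriv X f t d ->
  forall e, 0 < e -> exists2 de, 0 < de &
    forall s, X s -> `|s - t| < de -> `|f s - f t| < e.
Proof.
move=> Xt fd e e0.
set m := sigma X t - t.
have m0 : 0 <= m by rewrite subr_ge0 sigma_ge.
set k := e / (4 * (m + 1)).
have k0 : 0 < k by rewrite divr_gt0// mulr_gt0//; lra.
have kE : k * (m + 1) = e / 4 by rewrite /k; field; lra.
have [de de0 H] := fd k k0.
set c := e / (4 * (`|d| + 1)).
have d0 := normr_ge0 d.
have c0 : 0 < c by rewrite divr_gt0// mulr_gt0//; lra.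
have cE : c * (`|d| + 1) = e / 4 by rewrite /c; field; lra.
exists (Num.min de (Num.min 1 c)); first by rewrite !lt_min de0 ltr01.
move=> s Xs; rewrite !lt_min => /andP[sde /andP[s1 sc]].
have H1 := H _ Xs sde.
have H2 : `|f (sigma X t) - f t - d * m| <= k * m.
  have := H t Xt; rewrite subrr normr0 => /(_ de0).
  by rewrite -/m (ger0_norm m0).
have H3 : `|sigma X t - s| <= m + 1.
  have -> : sigma X t - s = m + (t - s) by rewrite /m; lra.
  by rewrite (le_trans (ler_normD _ _))// (ger0_norm m0) lerD2l distrC ltW.
have H4 : k * `|sigma X t - s| <= k * (m + 1) by rewrite ler_pM2l.
have H5 : `|d * (s - t)| <= e / 4.
  rewrite normrM -cE [c * _]mulrC ler_pM//; [lra|exact: ltW].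
have -> : f s - f t = (f (sigma X t) - f t - d * m)
    - (f (sigma X t) - f s - d * (sigma X t - s)) + d * (s - t).
  by rewrite /m; ring.
have H6 : k * m <= k * (m + 1) by rewrite ler_pM2l//; lra.
apply: le_lt_trans (ler_normD _ _) _.
apply: (@le_lt_trans _ _ ((k * m + k * `|sigma X t - s|) + e / 4)); last by lra.
by apply: lerD => //; apply: le_trans (ler_normB _ _) _; exact: lerD.
Qed.

Lemma has_delta_derivD f h t d d' :
  has_delta_deriv X f t d -> has_delta_deriv X h t d' ->
  has_delta_deriv X (fun s => f s + h s) t (d + d').
Proof.
move=> fd hd e e0; have e2 : 0 < e / 2 by lra.
have [de de0 H] := fd _ e2; have [de' de'0 H'] := hd _ e2.
exists (Num.min de de'); first by rewrite lt_min de0.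
move=> s Xs; rewrite lt_min => /andP[/(H _ Xs) h1 /(H' _ Xs) h2].
set u := sigma X t in h1 h2 *.
have -> : f u + h u - (f s + h s) - (d + d') * (u - s)
  = (f u - f s - d * (u - s)) + (h u - h s - d' * (u - s)) by ring.
apply: le_trans (ler_normD _ _) _; apply: le_trans (lerD h1 h2) _; lra.
Qed.

Lemma has_delta_derivZ c f t d :
  has_delta_deriv X f t d -> has_delta_deriv X (fun s => c * f s) t (c * d).
Proof.
move=> fd e e0; have c0 := normr_ge0 c.
have k0 : 0 < e / (`|c| + 1) by rewrite divr_gt0//; lra.
have [de de0 H] := fd _ k0.
exists de => // s Xs /(H _ Xs); set u := sigma X t => h1.
have -> : c * f u - c * f s - c * d * (u - s) = c * (f u - f s - d * (u - s)).
  by ring.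
rewrite normrM.
have := ler_wpM2l c0 h1; move=> /le_trans; apply.
rewrite mulrA ler_wpM2r// mulrA ler_pdivrMr; lra.
Qed.

Lemma has_delta_deriv_cst c t : has_delta_deriv X (fun=> c) t 0.
Proof.
move=> e e0; exists 1 => // s _ _.
by rewrite subrr mul0r subrr normr0 mulr_ge0// ltW.
Qed.

Lemma has_delta_deriv_id t : has_delta_deriv X id t 1.
Proof.
move=> e e0; exists 1 => // s _ _.
by rewrite mul1r subrr normr0 mulr_ge0// ltW.
Qed.

(** The increment from s to u = sigma t splits as
    (f u - f s) h u + f s (h u - h s); continuity of f replaces f s by f t. *)
Lemma has_delta_derivM f h t d d' : X t ->
  has_delta_deriv X f t d -> has_delta_deriv X h t d' ->
  has_delta_deriv X (fun s => f s * h s) t (d * h (sigma X t) + f t * d').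
Proof.
move=> Xt fd hd e e0.
set u := sigma X t.
set k := `|h u| + `|f t| + 1 + `|d'|.
have hu0 := normr_ge0 (h u); have ft0 := normr_ge0 (f t).
have d'0 := normr_ge0 d'.
have k0 : 0 < k by rewrite /k; lra.
set r := Num.min 1 (e / k).
have r0 : 0 < r by rewrite /r lt_min ltr01/= divr_gt0.
have r1 : r <= 1 by rewrite /r ge_min lexx.
have rk : r * k <= e.
  by rewrite -ler_pdivlMr// /r ge_min lexx orbT.
have [d1 d10 H1] := fd _ r0; have [d2 d20 H2] := hd _ r0.
have [d3 d30 H3] := has_delta_deriv_continuous Xt fd r0.
exists (Num.min d1 (Num.min d2 d3)); first by rewrite !lt_min d10 d20.
move=> s Xs; rewrite !lt_min.
move=> /andP[/(H1 _ Xs) h1 /andP[/(H2 _ Xs) h2 /(H3 _ Xs) h3]].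
rewrite -/u in h1 h2 *.
have -> : f u * h u - f s * h s - (d * h u + f t * d') * (u - s)
  = (f u - f s - d * (u - s)) * h u + f s * (h u - h s - d' * (u - s))
    + (f s - f t) * d' * (u - s) by ring.
set w := `|u - s| in h1 h2 *; have w0 : 0 <= w by exact: normr_ge0.
have fs : `|f s| <= `|f t| + 1.
  have -> : f s = f t + (f s - f t) by ring.
  apply: le_trans (ler_normD _ _) _; rewrite lerD2l.
  by apply: le_trans r1; exact: ltW.
apply: (@le_trans _ _
  (r * w * `|h u| + (`|f t| + 1) * (r * w) + r * `|d'| * w)); last first.
  have -> : r * w * `|h u| + (`|f t| + 1) * (r * w) + r * `|d'| * w = r * k * w.
    by rewrite /k; ring.
  by rewrite ler_wpM2r.
apply: le_trans (ler_normD _ _) _; apply: lerD.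
  apply: le_trans (ler_normD _ _) _; apply: lerD; rewrite normrM.
    by rewrite ler_wpM2r.
  by apply: ler_pM.
rewrite !normrM ler_wpM2r// ler_wpM2r//; exact: ltW.
Qed.

(** Points s different from sigma t exist arbitrarily close to t: t itself if t
    is right-scattered, points on the right if it is right-dense and below b,
    and points on the left if t = b. *)
Lemma has_delta_deriv_unique f t d d' : kappa X t ->
  has_delta_deriv X f t d -> has_delta_deriv X f t d' -> d = d'.
Proof.
move=> kt fd fd'; have Xt := kappa_sub kt.
apply/eqP; rewrite -subr_eq0 -normr_eq0; apply/negPn/negP => dd.
set e := `|d - d'| / 3.
have e0 : 0 < e by rewrite divr_gt0// lt0r dd normr_ge0.
have [d1 d10 H1] := fd _ e0; have [d2 d20 H2] := fd' _ e0.
suff [s [Xs sd us]] : exists s,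
    [/\ X s, `|s - t| < Num.min d1 d2 & sigma X t != s].
  move: sd; rewrite lt_min => /andP[/(H1 _ Xs) h1 /(H2 _ Xs)].
  set u := sigma X t in us h1 * => h2.
  have w0 : 0 < `|u - s| by rewrite normr_gt0 subr_eq0.
  have : `|(d - d') * (u - s)| <= 2 * e * `|u - s|.
    have -> : (d - d') * (u - s)
      = (f u - f s - d' * (u - s)) - (f u - f s - d * (u - s)) by ring.
    by apply: le_trans (ler_normB _ _) _; apply: le_trans (lerD h2 h1) _; lra.
  by rewrite normrM ler_pM2r// /e => h; move: e0; rewrite /e; lra.
have m0 : 0 < Num.min d1 d2 by rewrite lt_min d10.
have := sigma_ge Xt; rewrite le_eqVlt => /orP[/eqP st|st]; last first.
  by exists t; rewrite subrr normr0 gt_eqF.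
rewrite -st.
have [tb|[tb rb]] := kappaP kt.
  have [s [Xs ts sm]] := right_dense_adherent Xt tb (esym st) m0.
  exists s; rewrite lt_eqF//; split=> //.
  rewrite gtr0_norm ?subr_gt0//; lra.
have [s [Xs ts sm]] := left_dense_adherent Xb ab rb m0.
rewrite tb; exists s; rewrite gt_eqF//; split=> //.
rewrite ltr0_norm ?subr_lt0//; lra.
Qed.

Lemma delta_derivE f t d : kappa X t -> has_delta_deriv X f t d ->
  delta_deriv X f t = d.
Proof.
move=> kt fd; apply: (has_delta_deriv_unique kt _ fd).
by apply: (@getPex _ [set d | has_delta_deriv X f t d]); exists d.
Qed.

Lemma C1rd_deriv f t : C1rd X f -> kappa X t ->
  has_delta_deriv X f t (delta_deriv X f t).
Proof.
by move=> [H _] kt; have [d fd] := H t kt; rewrite (delta_derivE kt fd).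
Qed.


(** * Monotonicity and uniqueness of antiderivatives *)

(** An antiderivative is not constrained at b when b is left-scattered, but
    then b is isolated. *)
Lemma antiderivative_continuous F f t : antiderivative X f F -> X t ->
  forall e, 0 < e -> exists2 de, 0 < de &
    forall s, X s -> `|s - t| < de -> `|F s - F t| < e.
Proof.
move=> Ff Xt e e0.
have [kt|nkt] := pselect (kappa X t).
  exact: (has_delta_deriv_continuous Xt (Ff t kt)).
have tb : t = b.
  apply/le_anti; rewrite Xle//= leNgt; apply/negP => tb.
  by apply: nkt; exact: kappa_lt.
have rb : rho X b < b.
  rewrite lt_neqAle (rho_le Xb) andbT; apply/eqP => rb.
  by apply: nkt; rewrite tb; exact: kappa_left_dense.
rewrite tb; exists (b - rho X b); first by rewrite subr_gt0.
move=> s Xs; have [sb|bs] := ltP s b.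
  have /andP[sr _] := rho_prev Xs sb.
  by rewrite ltr0_norm ?subr_lt0// => h; exfalso; move: sr h; lra.
have -> : s = b by apply/le_anti; rewrite Xle.
by move=> _; rewrite subrr normr0.
Qed.

(** Induction along the scale: the points up to which F has dropped by at most
    e times the distance from s form a set that contains its supremum c, since F
    is continuous.  If c were below t, the derivative at c would carry the bound
    beyond c, by a jump to sigma c or to nearby points on the right. *)
Lemma antiderivative_nondecreasing F f : antiderivative X f F ->
  (forall t, kappa X t -> 0 <= f t) ->
  forall s t, X s -> X t -> s <= t -> F s <= F t.
Proof.
move=> Ff f0 s t Xs Xt st.
suff H : forall e, 0 < e -> F s - F t <= e * (t - s).
  rewrite leNgt; apply/negP => Fts.
  have e0 : 0 < (F s - F t) / (2 * (t - s + 1)) by rewrite divr_gt0//; lra.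
  have := H _ e0; rewrite mulrAC ler_pdivlMr; last by lra.
  nra.
move=> e e0; set P := fun u => F s - F u <= e * (u - s).
pose A := [set c | [/\ X c, s <= c & forall u, X u -> s <= u <= c -> P u]].
have As : A s.
  split=> // u _ /le_anti <-; by rewrite /P !subrr mulr0.
have hA : has_sup A by split; [exists s|exists b => c [/Xle]].
set c := sup A.
have sc : s <= c by apply: (sup_upper_bound hA).
have leA v : A v -> v <= c by move=> Av; apply: (sup_upper_bound hA).
have nearA de : 0 < de -> exists2 v, A v & `|v - c| < de.
  move=> de0; have [v Av vc] := sup_adherent de0 hA.
  exists v => //; rewrite distrC ger0_norm ?subr_ge0; last exact: leA.
  by rewrite ltrBlDr -ltrBlDl.
have Xc : X c.
  by apply: closed_adherent => // de /nearA [v [Xv _ _] vc]; exists v.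
have Pc : P c.
  rewrite /P leNgt; apply/negP => nP.
  have e1 : 0 < F s - F c - e * (c - s) by rewrite subr_gt0.
  have [de de0 H] := antiderivative_continuous Ff Xc e1.
  have [v Av vc] := nearA _ de0.
  have [Xv sv Pv] := Av.
  have := H v Xv vc; rewrite ltr_norml => /andP[_].
  have := Pv v Xv; rewrite sv lexx /P => /(_ isT) h1 h2.
  have : e * (v - s) <= e * (c - s) by rewrite ler_pM2l// lerD2r leA.
  lra.
have Ac : A c.
  split=> // u Xu /andP[su]; rewrite le_eqVlt => /orP[/eqP->//|uc].
  have e1 : 0 < c - u by rewrite subr_gt0.
  have [v Av] := nearA _ e1; rewrite ltr_norml => /andP[uv _].
  have [_ _] := Av; apply=> //; rewrite su /=; lra.
have [tc|ct] := leP t c; first by have [_ _] := Ac; apply; rewrite ?st.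
exfalso.
have cb : c < b by apply: lt_le_trans (Xle Xt).
have kc := kappa_lt Xc cb.
have [de de0 H] := Ff c kc e e0.
have fc0 := f0 c kc.
have : exists v, [/\ X v, c < v & forall u, X u -> c < u <= v -> P u].
  have := sigma_ge Xc; rewrite le_eqVlt => /orP[/eqP st'|st'].
    have [v [Xv cv vde]] := right_dense_adherent Xc cb (esym st') de0.
    exists v; split=> // u Xu /andP[cu uv].
    have := H u Xu; rewrite -st' [`|c - u|]distrC gtr0_norm ?subr_gt0//.
    have -> : u - c < de by lra.
    move=> /(_ isT); rewrite ler_norml => /andP[_]; rewrite /P in Pc *.
    nra.
  exists (sigma X c); split=> //; first exact: sigma_in.
  move=> u Xu /andP[cu uS].
  have -> : u = sigma X c by apply/le_anti; rewrite uS lt_sigma.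
  have := H c Xc; rewrite subrr normr0 => /(_ de0).
  rewrite [`|sigma X c - c|]gtr0_norm ?subr_gt0//.
  rewrite ler_norml => /andP[+ _]; rewrite /P in Pc *.
  have : 0 <= f c * (sigma X c - c) by rewrite mulr_ge0// subr_ge0 ltW.
  nra.
move=> [v [Xv cv Pv]].
suff /leA : A v by rewrite leNgt cv.
split=> //; first by apply: le_trans sc _; exact: ltW.
move=> u Xu /andP[su uv]; have [uc|cu] := leP u c.
  by have [_ _] := Ac; apply; rewrite ?su.
by apply: Pv; rewrite ?cu.
Qed.

Lemma antiderivative_eq f h F : (forall t, kappa X t -> f t = h t) ->
  antiderivative X f F -> antiderivative X h F.
Proof. by move=> fh Ff t kt; rewrite -fh//; exact: Ff. Qed.

Lemma antiderivativeD f h F G : antiderivative X f F -> antiderivative X h G ->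
  antiderivative X (fun t => f t + h t) (fun t => F t + G t).
Proof.
by move=> Ff Gh t kt; apply: has_delta_derivD; [exact: Ff|exact: Gh].
Qed.

Lemma antiderivativeZ c f F : antiderivative X f F ->
  antiderivative X (fun t => c * f t) (fun t => c * F t).
Proof. by move=> Ff t kt; apply: has_delta_derivZ; exact: Ff. Qed.

Lemma antiderivative_linear c : antiderivative X (fun=> c) (fun t => c * t).
Proof.
move=> t _; rewrite -[X in has_delta_deriv _ _ _ X](mulr1 c).
exact/has_delta_derivZ/has_delta_deriv_id.
Qed.

Lemma antiderivative_le F G f h :
  antiderivative X f F -> antiderivative X h G ->
  (forall t, kappa X t -> f t <= h t) ->
  forall s t, X s -> X t -> s <= t -> F t - F s <= G t - G s.
Proof.
move=> Ff Gh fh s t Xs Xt st.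
have D := antiderivativeD Gh (antiderivativeZ (-1) Ff).
have h0 t' : kappa X t' -> 0 <= h t' + -1 * f t' by move/fh; lra.
by have := antiderivative_nondecreasing D h0 Xs Xt st; lra.
Qed.

Lemma antiderivative_mean_value F f K : antiderivative X f F ->
  (forall t, kappa X t -> `|f t| <= K) -> `|F b - F a| <= K * (b - a).
Proof.
move=> Ff fK; have ab' := ltW ab.
have fK' t : kappa X t -> - K <= f t <= K by move/fK; rewrite ler_norml.
have fle t : kappa X t -> f t <= K by move=> /fK' /andP[].
have fge t : kappa X t -> - K <= f t by move=> /fK' /andP[].
have := antiderivative_le Ff (antiderivative_linear K) fle Xa Xb ab'.
have := antiderivative_le (antiderivative_linear (- K)) Ff fge Xa Xb ab'.
by rewrite ler_norml => h1 h2; apply/andP; split; lra.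
Qed.

Lemma antiderivative_increment F G f s t : antiderivative X f F ->
  antiderivative X f G -> X s -> X t -> F t - F s = G t - G s.
Proof.
move=> Ff Gf; wlog st : s t / s <= t.
  move=> W Xs Xt; have [/W|/ltW/W] := leP s t; first exact.
  by move=> /(_ Xt Xs); lra.
move=> Xs Xt; apply/le_anti/andP; split.
  exact: (antiderivative_le Ff Gf).
exact: (antiderivative_le Gf Ff).
Qed.

Lemma delta_integralE f F s t : antiderivative X f F -> X s -> X t ->
  delta_integral X f s t = F t - F s.
Proof.
move=> Ff Xs Xt; rewrite /delta_integral.
have : exists v, exists2 G, antiderivative X f G & v = G t - G s.
  by exists (F t - F s), F.
move=> /(@getPex _ [set v | exists2 G, antiderivative X f G & v = G t - G s]).
by move=> [G Gf ->]; exact: antiderivative_increment Gf Ff Xs Xt.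
Qed.

(** F is nondecreasing with equal end values, hence constant, and delta
    derivatives are unique. *)
Lemma antiderivative_ge0_eq0 F f : antiderivative X f F ->
  (forall t, kappa X t -> 0 <= f t) -> F b = F a ->
  forall t, kappa X t -> f t = 0.
Proof.
move=> Ff f0 Fab t kt.
have mono := antiderivative_nondecreasing Ff f0.
have Fa s : X s -> F s = F a.
  move=> Xs; apply/le_anti/andP; split; first by rewrite -Fab mono ?Xle.
  by rewrite mono ?Xge.
apply: (has_delta_deriv_unique kt (Ff t kt)).
move=> e e0; exists 1 => // s Xs _.
rewrite !Fa//; last by apply: sigma_in; exact: kappa_sub.
by rewrite subrr mul0r subrr normr0 mulr_ge0// ltW.
Qed.

(** * Rd-continuous functions *)

Lemma cvg_within_dist (D : set R) f t l :
  f s @[s --> within D (nbhs t)] --> l <->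
  forall e : R, 0 < e -> exists2 de : R, 0 < de &
    forall s, D s -> `|s - t| < de -> `|f s - l| < e.
Proof.
split=> [/cvgrPdist_lt H e e0|H].
  have := H e e0; rewrite near_withinE => /nbhs_ballP[de /= de0 hde].
  exists de => // s Ds sd; rewrite distrC; apply: hde => //.
  by rewrite /ball/= distrC.
apply/cvgrPdist_lt => e e0; have [de de0 hde] := H e e0.
rewrite near_withinE; apply/nbhs_ballP; exists de => //= s.
by rewrite /ball/= distrC => sd Ds; rewrite distrC hde.
Qed.

Lemma cvg_within_left_dist (D : set R) f t l :
  f s @[s --> within D t^'-] --> l <->
  forall e : R, 0 < e -> exists2 de : R, 0 < de &
    forall s, D s -> s < t -> `|s - t| < de -> `|f s - l| < e.
Proof.
split=> [/cvgrPdist_lt H e e0|H].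
  have := H e e0; rewrite !near_withinE => /nbhs_ballP[de /= de0 hde].
  exists de => // s Ds st sd; rewrite distrC; apply: hde => //.
  by rewrite /ball/= distrC.
apply/cvgrPdist_lt => e e0; have [de de0 hde] := H e e0.
rewrite !near_withinE; apply/nbhs_ballP; exists de => //= s.
by rewrite /ball/= distrC => sd st Ds; rewrite distrC hde.
Qed.

Lemma rd_continuous_eq (D : set R) f h : (forall t, D t -> f t = h t) ->
  rd_continuous X D f -> rd_continuous X D h.
Proof.
move=> fh fc t Dt; have [c1 c2] := fc t Dt; split.
  move=> /c1; rewrite -fh// => /cvg_within_dist H; apply/cvg_within_dist.
  move=> e /H[de de0 hde]; exists de => // s Ds; rewrite -fh//; exact: hde.
move=> /c2[l /cvg_within_left_dist H]; exists l; apply/cvg_within_left_dist.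
move=> e /H[de de0 hde]; exists de => // s Ds; rewrite -fh//; exact: hde.
Qed.

Lemma rd_continuousD (D : set R) f h :
  rd_continuous X D f -> rd_continuous X D h ->
  rd_continuous X D (fun t => f t + h t).
Proof.
move=> fc hc t Dt; have [f1 f2] := fc t Dt; have [h1 h2] := hc t Dt; split.
  by move=> /[dup] /f1 ? /h1 ?; exact: cvgD.
by move=> /[dup] /f2[l ?] /h2[k ?]; exists (l + k); exact: cvgD.
Qed.

Lemma rd_continuousM (D : set R) f h :
  rd_continuous X D f -> rd_continuous X D h ->
  rd_continuous X D (fun t => f t * h t).
Proof.
move=> fc hc t Dt; have [f1 f2] := fc t Dt; have [h1 h2] := hc t Dt; split.
  by move=> /[dup] /f1 ? /h1 ?; exact: cvgM.
by move=> /[dup] /f2[l ?] /h2[k ?]; exists (l * k); exact: cvgM.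
Qed.

Lemma rd_continuous_cst (D : set R) c : rd_continuous X D (fun=> c).
Proof.
by move=> t Dt; split=> [_|_]; [exact: cvg_cst|exists c; exact: cvg_cst].
Qed.

Lemma rd_continuousZ (D : set R) c f : rd_continuous X D f ->
  rd_continuous X D (fun t => c * f t).
Proof. exact/rd_continuousM/rd_continuous_cst. Qed.

Lemma antiderivative_rd_continuous F f : antiderivative X f F ->
  rd_continuous X (kappa X) F.
Proof.
move=> Ff t kt.
have H := antiderivative_continuous Ff (kappa_sub kt).
split=> [_|_]; [apply/cvg_within_dist|exists (F t); apply/cvg_within_left_dist].
  by move=> e /H[de de0 hde]; exists de => // s /kappa_sub Xs; exact: hde.
by move=> e /H[de de0 hde]; exists de => // s /kappa_sub Xs _; exact: hde.
Qed.

Lemma compact_scale_compact : compact X.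
Proof.
apply: (subclosed_compact clX (@segment_compact R a b)).
by move=> t Xt; rewrite /= in_itv /= Xge// Xle.
Qed.

Lemma locally_bounded_bounded (D : set R) f :
  (forall t, X t -> exists M : R, exists2 de : R, 0 < de &
     forall s, D s -> `|s - t| < de -> `|f s| <= M) ->
  exists2 M : R, 0 <= M & forall t, X t -> D t -> `|f t| <= M.
Proof.
move=> loc.
have /compact_near_coveringP cov := compact_scale_compact.
have := cov R +oo (fun M t => D t -> `|f t| <= M) _.
case=> [t Xt|N [Nr HN]].
  have [M [de de0 hde]] := loc t Xt.
  exists (ball t de, [set M' | M < M']).
    split; first by apply: nbhsx_ballx.
    by exists M; split=> //; exact: num_real.
  move=> [s M'] /= [sd MM'] Ds; apply: le_trans (ltW MM').
  by apply: hde => //; rewrite distrC.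
exists (Num.max 0 (N + 1)) => [|t Xt Dt]; first by rewrite le_max lexx.
by rewrite le_max; apply/orP; right; apply: HN => //; rewrite ltrDl.
Qed.

Lemma antiderivative_bounded F f : antiderivative X f F ->
  exists2 M : R, 0 <= M & forall t, X t -> `|F t| <= M.
Proof.
move=> Ff; have [|M M0 HM] := @locally_bounded_bounded X F.
  move=> t Xt; have [de de0 H] := antiderivative_continuous Ff Xt ltr01.
  exists (`|F t| + 1), de => // s Xs /(H s Xs) h.
  have -> : F s = F t + (F s - F t) by ring.
  by apply: le_trans (ler_normD _ _) _; rewrite lerD2l ltW.
by exists M => // t Xt; exact: HM.
Qed.

(** Near a point t of X the function is controlled on the right by continuity
    or by the gap after t, and on the left by its left limit or by the gap
    before t; compactness does the rest. *)
Lemma rd_continuous_bounded f : rd_continuous X (kappa X) f ->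
  exists2 M : R, 0 <= M & forall t, kappa X t -> `|f t| <= M.
Proof.
move=> fc; have [|M M0 HM] := @locally_bounded_bounded (kappa X) f; last first.
  by exists M => // t kt; apply: HM => //; exact: kappa_sub.
move=> t Xt.
have [Mr [dr dr0 Hr]] : exists M : R, exists2 de : R, 0 < de &
    forall s, kappa X s -> t <= s -> `|s - t| < de -> `|f s| <= M.
  have [kt|nkt] := pselect (kappa X t); last first.
    exists 0, 1 => // s ks ts; exfalso; apply: nkt.
    have [sb|[sb rb]] := kappaP ks.
      by apply: kappa_lt => //; exact: le_lt_trans sb.
    have [tb|bt] := ltP t b; first exact: kappa_lt.
    have -> : t = b by apply/le_anti; rewrite Xle.
    exact: kappa_left_dense.
  have := sigma_ge Xt; rewrite le_eqVlt => /orP[/eqP st|st].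
    have [/(_ (esym st)) /cvg_within_dist /(_ _ ltr01)[de de0 H] _] := fc t kt.
    exists (`|f t| + 1), de => // s ks _ /(H s ks) h.
    have -> : f s = f t + (f s - f t) by ring.
    by apply: le_trans (ler_normD _ _) _; rewrite lerD2l ltW.
  exists `|f t|, (sigma X t - t); first by rewrite subr_gt0.
  move=> s /kappa_sub Xs; rewrite le_eqVlt => /orP[/eqP->//|ts].
  have := lt_sigma Xt Xs ts; rewrite gtr0_norm ?subr_gt0//; lra.
have [Ml [dl dl0 Hl]] : exists M : R, exists2 de : R, 0 < de &
    forall s, kappa X s -> s < t -> `|s - t| < de -> `|f s| <= M.
  have := rho_le Xt; rewrite le_eqVlt => /orP[/eqP rt|rt]; last first.
    exists 0, (t - rho X t); first by rewrite subr_gt0.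
    move=> s /kappa_sub Xs st.
    have /andP[h _] := rho_prev Xs st.
    rewrite ltr0_norm ?subr_lt0//; lra.
  have kt : kappa X t.
    have [tb|bt] := ltP t b; first exact: kappa_lt.
    have tb : t = b by apply/le_anti; rewrite Xle.
    by rewrite tb in rt *; exact: kappa_left_dense.
  have [_ /(_ rt) [l /cvg_within_left_dist /(_ _ ltr01)[de de0 H]]] := fc t kt.
  exists (`|l| + 1), de => // s ks st /(H s ks st) h.
  have -> : f s = l + (f s - l) by ring.
  by apply: le_trans (ler_normD _ _) _; rewrite lerD2l ltW.
exists (Num.max Mr Ml), (Num.min dr dl); first by rewrite lt_min dr0.
move=> s ks; rewrite lt_min le_max => /andP[sr sl].
have [ts|st] := leP t s; first by rewrite Hr.
by rewrite Hl// orbT.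
Qed.

(** * Existence of antiderivatives *)

(** The bounds are those satisfied by an integral of f over [s, t).  At a
    right-scattered point they determine the increment over the gap exactly;
    at a right-dense point continuity makes the bounds collapse to f t. *)
Lemma interval_bounds_antiderivative f F :
  rd_continuous X (kappa X) f ->
  (forall (s t m M : R), X s -> X t -> s <= t ->
     (forall u, X u -> s <= u < t -> m <= f u <= M) ->
     m * (t - s) <= F t - F s <= M * (t - s)) ->
  antiderivative X f F.
Proof.
move=> fc HF t kt e e0; have Xt := kappa_sub kt.
have [K K0 fK] := rd_continuous_bounded fc.
(* The hypothesis in the form in which both halves use it, with s and u in
   either order. *)
have key (M c s u : R) : 0 <= M -> X s -> X u ->
    (forall v, kappa X v -> Num.min s u <= v < Num.max s u ->
       `|f v - c| <= M) ->
    `|F u - F s - c * (u - s)| <= M * `|u - s|.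
  move=> M0.
  wlog su : s u / s <= u.
    move=> W; have /orP[/W//|us Xs Xu H] := le_total s u.
    have -> : F u - F s - c * (u - s) = - (F s - F u - c * (s - u)) by ring.
    rewrite normrN [`|u - s|]distrC; apply: W => // v kv.
    by rewrite minC maxC; exact: H.
  rewrite min_l// max_r// => Xs Xu H.
  have fcM v : X v -> s <= v < u -> c - M <= f v <= c + M.
    move=> Xv /andP[sv vu].
    have kv : kappa X v.
      by apply: kappa_lt => //; exact: lt_le_trans vu (Xle Xu).
    have := H v kv; rewrite sv vu => /(_ isT); rewrite ler_norml => /andP[? ?].
    by apply/andP; split; lra.
  have /andP[h1 h2] := HF _ _ _ _ Xs Xu su fcM.
  by rewrite [`|u - s|]ger0_norm ?subr_ge0// ler_norml; apply/andP; split; lra.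
have := sigma_ge Xt; rewrite le_eqVlt => /orP[/eqP st|st].
  have [/(_ (esym st)) /cvg_within_dist /(_ _ e0)[de de0 H] _] := fc t kt.
  exists de => // s Xs sd; rewrite -st; apply: key => //; first exact: ltW.
  move=> v kv vst; apply/ltW/H => //; apply: le_lt_trans sd.
  move: vst; rewrite ge_min lt_max; have [ts|ts] := leP t s.
    rewrite [`|s - t|]ger0_norm ?subr_ge0// ler_norml.
    by move=> /andP[/orP[] ? /orP[] ?]; apply/andP; split; lra.
  rewrite [`|s - t|]ltr0_norm ?subr_lt0// ler_norml.
  by move=> /andP[/orP[] ? /orP[] ?]; apply/andP; split; lra.
set mu := sigma X t - t; have mu0 : 0 < mu by rewrite subr_gt0.
have [_ _ gap] := sigma_next Xt (lt_le_trans st (Xle (sigma_in Xt))).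
(* Between t and sigma t only the value f t counts. *)
have Ft : F (sigma X t) - F t = f t * mu.
  have : `|F (sigma X t) - F t - f t * mu| <= 0 * `|mu|.
    apply: key => //; first exact: sigma_in.
    move=> v kv; rewrite min_l ?(ltW st)// max_r ?(ltW st)// => /andP[tv vs].
    have -> : v = t; last by rewrite subrr normr0.
    apply/le_anti; rewrite tv andbT leNgt; apply/negP => tv'.
    by have := gap v (kappa_sub kv) tv'; rewrite leNgt vs.
  by rewrite mul0r normr_le0 subr_eq0 => /eqP.
set k := e * mu / (2 * K + 1).
have k0 : 0 < k by rewrite divr_gt0 ?mulr_gt0//; lra.
have kE : k * (2 * K + 1) = e * mu by rewrite /k; field; lra.
exists (Num.min mu k); first by rewrite lt_min mu0.
move=> s Xs; rewrite lt_min => /andP[smu sk].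
have sle : s <= t.
  rewrite leNgt; apply/negP => ts; have := gap s Xs ts.
  by rewrite gtr0_norm ?subr_gt0// in smu; move: smu; rewrite /mu; lra.
have -> : F (sigma X t) - F s - f t * (sigma X t - s)
    = F t - F s - f t * (t - s).
  have -> : F (sigma X t) = F t + f t * mu by rewrite -Ft; ring.
  by rewrite /mu; ring.
have h1 : `|F t - F s - f t * (t - s)| <= 2 * K * `|t - s|.
  apply: key => //; first by lra.
  move=> v kv _; apply: le_trans (ler_normB _ _) _.
  by have := fK v kv; have := fK t kt; lra.
apply: le_trans h1 _.
rewrite [`|sigma X t - s|]gtr0_norm; last by rewrite subr_gt0 (le_lt_trans sle).
apply: (@le_trans _ _ (e * mu)); last by rewrite ler_pM2l// /mu; lra.
rewrite -kE distrC mulrC; apply: ler_pM => //; first by lra.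
  exact: ltW.
by lra.
Qed.

(** F is the pointwise supremum of the
    functions G with G a = 0 whose increment over [s, t) is at most M (t - s)
    whenever f <= M there.  The upper bounds on increments pass to the supremum.
    For the lower bounds, a competitor G can be continued after s with slope m
    as long as m <= f, so F must grow at least as fast. *)
Lemma rd_continuous_antiderivative f : rd_continuous X (kappa X) f ->
  exists F, antiderivative X f F.
Proof.
move=> fc.
have [K K0 fK] := rd_continuous_bounded fc.
have fK' u v : X u -> X v -> u < v -> - K <= f u <= K.
  move=> Xu Xv uv; rewrite -ler_norml fK//; apply: kappa_lt => //.
  exact: lt_le_trans uv (Xle Xv).
pose sub (G : R -> R) := G a = 0 /\ forall (s t M : R), X s -> X t -> s < t ->
  (forall u, X u -> s <= u < t -> f u <= M) -> G t - G s <= M * (t - s).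
pose V t := [set G t | G in sub].
have sub0 : sub (fun t => - K * (t - a)).
  split; first by rewrite subrr mulr0.
  move=> s t M Xs Xt st fM.
  have -> : - K * (t - a) - - K * (s - a) = - K * (t - s) by ring.
  rewrite ler_pM2r ?subr_gt0//.
  have /andP[h _] := fK' s t Xs Xt st; apply: le_trans h _; apply: fM => //.
  by rewrite lexx.
have V0 t : V t !=set0 by exists (- K * (t - a)), (fun t => - K * (t - a)).
have supV t : X t -> has_sup (V t).
  move=> Xt; split; first exact: V0.
  exists (K * (t - a)) => _ [G [Ga Gs] <-].
  have := Xge Xt; rewrite [a <= t]le_eqVlt => /orP[/eqP <-|ta].
    by rewrite Ga subrr mulr0.
  have := Gs a t K Xa Xt ta; rewrite Ga subr0; apply.
  move=> u Xu /andP[_ ut]; by have /andP[] := fK' u t Xu Xt ut.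
exists (fun t => sup (V t)); apply: interval_bounds_antiderivative => //.
move=> s t m M Xs Xt; rewrite [s <= t]le_eqVlt => /orP[/eqP-> _|st fmM].
  by rewrite !subrr !mulr0 lexx.
apply/andP; split; last first.
  rewrite lerBlDl; apply: ge_sup; first exact: V0.
  move=> _ [G sG <-].
  have : G s <= sup (V s) by apply: (sup_upper_bound (supV s Xs)); exists G.
  have := sG.2 s t M Xs Xt st (fun u Xu i => proj2 (andP (fmM u Xu i))).
  lra.
suff H : forall G, sub G -> G s + m * (t - s) <= sup (V t).
  rewrite lerBrDl -lerBrDr; apply: ge_sup; first exact: V0.
  by move=> _ [G sG <-]; rewrite lerBrDr; exact: H.
move=> G [Ga Gs].
(* The continuation of G: slope m on [s, t], then slope - K, which is below f
   everywhere. *)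
pose G' u := if u <= s then G u
  else G s + m * (Num.min u t - s) - K * (Num.max u t - t).
have G't : G' t = G s + m * (t - s).
  by rewrite /G' leNgt st /= minxx maxxx subrr mulr0 subr0.
rewrite -G't; apply: (sup_upper_bound (supV t Xt)); exists G' => //; split.
  by rewrite /G' Xge.
move=> u v M' Xu Xv uv fM'.
have inst w : X w -> u <= w < v -> f w <= M' by exact: fM'.
have h1 : u <= s -> s < v -> m <= M'.
  move=> us sv; apply: le_trans (inst s Xs _); last by rewrite us.
  by have := fmM s Xs; rewrite lexx st => /(_ isT)/andP[].
have h2 : s < u -> u < t -> m <= M'.
  move=> su ut; apply: le_trans (inst u Xu _); last by rewrite lexx.
  by have := fmM u Xu; rewrite (ltW su) ut => /(_ isT)/andP[].
have h3 : - K <= M'.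
  have /andP[h _] := fK' u v Xu Xv uv; apply: le_trans h (inst u Xu _).
  by rewrite lexx.
have h4 : u < s -> G s - G u <= M' * (s - u) \/ v < s.
  move=> us; have [vs|sv] := ltP v s; [by right|left].
  apply: Gs => // w Xw /andP[uw ws]; apply: inst => //.
  by rewrite uw (lt_le_trans ws).
have h5 : v <= s -> G v - G u <= M' * (v - u) by move=> vs; exact: Gs.
rewrite /G'.
have [us|su] := leP u s; have [vs|sv] := leP v s.
- exact: h5.
- have hm := h1 us sv.
  have hu : G s - G u <= M' * (s - u).
    move: us; rewrite [u <= s]le_eqVlt => /orP[/eqP ->|/h4[//|]].
      by rewrite !subrr mulr0.
    by move=> vs; move: vs sv; lra.
  have [vt|tv] := leP v t; first by nra.
  nra.
- by move: su uv vs; lra.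
have [ut|tu] := ltP u t; last first.
  have tv : t <= v by apply: le_trans tu (ltW uv).
  rewrite !min_r ?max_l//; nra.
have hm := h2 su ut.
have [vt|tv] := leP v t; nra.
Qed.

(** * First variation of a functional *)

Lemma C1rd_antiderivative y : C1rd X y -> antiderivative X (delta_deriv X y) y.
Proof. by move=> yC t; exact: (C1rd_deriv yC). Qed.

Lemma antiderivative_C1rd f F : rd_continuous X (kappa X) f ->
  antiderivative X f F -> C1rd X F.
Proof.
move=> fc Ff; split=> [t kt|]; first by exists (f t); exact: Ff.
by apply: rd_continuous_eq fc => t kt; rewrite (delta_derivE kt (Ff t kt)).
Qed.

Lemma delta_derivD y h t : C1rd X y -> C1rd X h -> kappa X t ->
  delta_deriv X (fun s => y s + h s) t = delta_deriv X y t + delta_deriv X h t.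
Proof.
move=> yC hC kt; apply: (delta_derivE kt).
by apply: has_delta_derivD; exact: C1rd_deriv.
Qed.

Lemma delta_derivZ c y t : C1rd X y -> kappa X t ->
  delta_deriv X (fun s => c * y s) t = c * delta_deriv X y t.
Proof.
by move=> yC kt; apply/(delta_derivE kt)/has_delta_derivZ/C1rd_deriv.
Qed.

Lemma C1rdD y h : C1rd X y -> C1rd X h -> C1rd X (fun t => y t + h t).
Proof.
move=> yC hC; apply: antiderivative_C1rd; last first.
  exact: antiderivativeD (C1rd_antiderivative yC) (C1rd_antiderivative hC).
by apply: rd_continuousD; [case: yC|case: hC].
Qed.

Lemma C1rdZ c y : C1rd X y -> C1rd X (fun t => c * y t).
Proof.
move=> yC; apply: antiderivative_C1rd; last first.
  exact: antiderivativeZ (C1rd_antiderivative yC).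
by apply: rd_continuousZ; case: yC.
Qed.

(** First-order expansion of the integrand with an error that is uniform in t:
    change x and v one after the other and use the mean value theorem twice. *)
Lemma lagrangian_increment (L : R -> R -> R -> R) (M e : R) :
  continuous_partials X L -> 0 < e -> exists2 de : R, 0 < de &
    forall t x v p q c, kappa X t -> `|x| <= M -> `|v| <= M ->
      `|p| <= c -> `|q| <= c -> c < de ->
      `|L t (x + p) (v + q) - L t x v
        - (partial_x L t x v * p + partial_v L t x v * q)| <= e * c.
Proof.
move=> [dx dv ex ev] e0; have e2 : 0 < e / 2 by lra.
have [d1 d10 H1] := equicontinuous_uniform_on_box M ex e2.
have [d2 d20 H2] := equicontinuous_uniform_on_box M ev e2.
exists (Num.min d1 d2); first by rewrite lt_min d10.
move=> t x v p q c kt xM vM pc qc; rewrite lt_min => /andP[c1 c2].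
have c0 : 0 <= c by apply: le_trans pc; exact: normr_ge0.
have [z zp Ez] := mean_value_increment x p (fun z => dx t z (v + q) kt).
have [w wq Ew] := mean_value_increment v q (fun z => dv t x z kt).
have -> : L t (x + p) (v + q) - L t x v
    - (partial_x L t x v * p + partial_v L t x v * q)
  = (partial_x L t z (v + q) - partial_x L t x v) * p
    + (partial_v L t x w - partial_v L t x v) * q.
  by rewrite !mulrBl /partial_x /partial_v -Ez -Ew; ring.
have -> : e * c = e / 2 * c + e / 2 * c by field.
apply: le_trans (ler_normD _ _) _.
apply: lerD; rewrite normrM; apply: ler_pM => //.
  rewrite distrC; apply: H1 => //; first exact: le_lt_trans (le_trans zp pc) c1.
  have -> : v + q - v = q by ring.
  exact: le_lt_trans qc c1.
rewrite distrC; apply: H2 => //; first by rewrite subrr normr0.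
exact: le_lt_trans (le_trans wq qc) c2.
Qed.

(** With A an antiderivative of L_x along y, this is the function against which
    h^Delta is integrated in the first variation of L at y. *)
Definition reduced_momentum (L : R -> R -> R -> R) A y t : R :=
  along X (partial_v L) y t - A t.

Lemma reduced_momentum_rd_continuous (L : R -> R -> R -> R) A y :
  lagrangian X L -> C1rd X y -> antiderivative X (along X (partial_x L) y) A ->
  rd_continuous X (kappa X) (reduced_momentum L A y).
Proof.
move=> [_ lL] yC Ax.
apply: (rd_continuous_eq
  (f := fun t => along X (partial_v L) y t + -1 * A t)).
  by move=> t _; rewrite /reduced_momentum; ring.
apply: rd_continuousD; first by have [_ _] := lL y yC.
exact/rd_continuousZ/(antiderivative_rd_continuous Ax).
Qed.

(** By the product rule, A h plus an antiderivative of
    (L_v - A) h^Delta is an antiderivative of L_x h^sigma + L_v h^Delta, and A h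
    vanishes at both ends.  So the difference to be estimated is the increment
    over [a, b] of a function whose delta derivative is the pointwise error of
    the expansion of L.  This avoids integrating h^sigma by itself. *)
Lemma functional_increment (L : R -> R -> R -> R) y A (e : R) :
  lagrangian X L -> C1rd X y ->
  antiderivative X (along X (partial_x L) y) A -> 0 < e ->
  exists2 de : R, 0 < de & forall h (c : R), C1rd X h -> h a = 0 -> h b = 0 ->
    (forall t, X t -> `|h t| <= c) ->
    (forall t, kappa X t -> `|delta_deriv X h t| <= c) -> c < de ->
    `|functional X L a b (fun t => y t + h t) - functional X L a b y
      - delta_integral X
          (fun t => reduced_momentum L A y t * delta_deriv X h t) a b|
      <= e * c.
Proof.
move=> lL yC Ax e0; have [pL rL] := lL.
have [M1 M10 HM1] := antiderivative_bounded (C1rd_antiderivative yC).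
have [M2 M20 HM2] := rd_continuous_bounded yC.2.
have e1 : 0 < e / (b - a) by rewrite divr_gt0// subr_gt0.
have [de de0 H] := lagrangian_increment (Num.max M1 M2) pL e1.
exists de => // h c hC ha hb hc h'c cde.
have yhC := C1rdD yC hC.
have [ry _ _] := rL y yC; have [ryh _ _] := rL _ yhC.
have [P PL] := rd_continuous_antiderivative ryh.
have [Q QL] := rd_continuous_antiderivative ry.
have rq : rd_continuous X (kappa X)
    (fun t => reduced_momentum L A y t * delta_deriv X h t).
  apply: rd_continuousM; last by case: hC.
  exact: reduced_momentum_rd_continuous.
have [G Gq] := rd_continuous_antiderivative rq.
rewrite /functional (delta_integralE PL)// (delta_integralE QL)//.
rewrite (delta_integralE Gq)//.
have AhG : antiderivative X
   (fun t => along X (partial_x L) y t * h (sigma X t)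
             + along X (partial_v L) y t * delta_deriv X h t)
   (fun t => A t * h t + G t).
  apply: (antiderivative_eq (f := fun t =>
    (along X (partial_x L) y t * h (sigma X t) + A t * delta_deriv X h t)
    + reduced_momentum L A y t * delta_deriv X h t)).
    by move=> t _; rewrite /reduced_momentum; ring.
  apply: antiderivativeD => // t kt.
  apply: (has_delta_derivM (kappa_sub kt) (Ax t kt)).
  exact: C1rd_deriv.
have E := antiderivativeD (antiderivativeD PL (antiderivativeZ (-1) QL))
  (antiderivativeZ (-1) AhG).
have := antiderivative_mean_value (K := e / (b - a) * c) E.
have -> : e / (b - a) * c * (b - a) = e * c by field; rewrite subr_eq0 gt_eqF.
rewrite ha hb !mulr0 !add0r.
have -> : P b + -1 * Q b + -1 * G b - (P a + -1 * Q a + -1 * G a)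
  = P b - P a - (Q b - Q a) - (G b - G a) by ring.
apply=> t kt; rewrite /along delta_derivD//.
have Xt := kappa_sub kt; have Xs := sigma_in Xt.
have := H t (y (sigma X t)) (delta_deriv X y t) (h (sigma X t))
  (delta_deriv X h t) c kt.
rewrite !mulN1r.
apply => //; [|by rewrite le_max HM2 ?orbT|exact: hc|exact: h'c].
by rewrite le_max HM1.
Qed.


Definition delta_inner f h : R := delta_integral X (fun t => f t * h t) a b.

Lemma delta_integral_linear f h k c d :
  rd_continuous X (kappa X) f -> rd_continuous X (kappa X) h ->
  (forall t, kappa X t -> k t = c * f t + d * h t) ->
  delta_integral X k a b
    = c * delta_integral X f a b + d * delta_integral X h a b.
Proof.
move=> fc hc kE.
have [F Ff] := rd_continuous_antiderivative fc.
have [H Hh] := rd_continuous_antiderivative hc.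
have Kk : antiderivative X k (fun t => c * F t + d * H t).
  apply: (antiderivative_eq (f := fun t => c * f t + d * h t)).
    by move=> t kt; rewrite kE.
  by apply: antiderivativeD; exact: antiderivativeZ.
rewrite (delta_integralE Ff)// (delta_integralE Hh)//.
by rewrite (delta_integralE Kk)//; ring.
Qed.

Lemma delta_inner_linear f h k g c d :
  rd_continuous X (kappa X) f -> rd_continuous X (kappa X) h ->
  rd_continuous X (kappa X) g ->
  (forall t, kappa X t -> k t = c * f t + d * h t) ->
  delta_inner g k = c * delta_inner g f + d * delta_inner g h.
Proof.
move=> fc hc gc kE; apply: delta_integral_linear; [exact: rd_continuousM..|].
by move=> t kt; rewrite kE//; ring.
Qed.

Lemma delta_innerC f h : delta_inner f h = delta_inner h f.
Proof.
rewrite /delta_inner; congr (delta_integral X _ a b).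
by apply/funext => t; ring.
Qed.

Lemma delta_inner_sqr_le0 f : rd_continuous X (kappa X) f ->
  delta_inner f f <= 0 -> forall t, kappa X t -> f t = 0.
Proof.
move=> fc; have [F Ff] := rd_continuous_antiderivative (rd_continuousM fc fc).
rewrite /delta_inner (delta_integralE Ff)// subr_le0 => Fba t kt.
have ff0 s : kappa X s -> 0 <= f s * f s by move=> _; rewrite -expr2 sqr_ge0.
have Fab := antiderivative_nondecreasing Ff ff0 Xa Xb (ltW ab).
have Feq : F b = F a by apply/le_anti; rewrite Fba.
have /eqP := antiderivative_ge0_eq0 Ff ff0 Feq kt.
by rewrite mulf_eq0 orbb => /eqP.
Qed.

Lemma functional_expansion (L : R -> R -> R -> R) y A w eta
    (q := reduced_momentum L A y) :
  lagrangian X L -> C1rd X y ->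
  antiderivative X (along X (partial_x L) y) A ->
  C1rd X w -> w a = 0 -> w b = 0 -> C1rd X eta -> eta a = 0 -> eta b = 0 ->
  expands_at0
    (fun s r => functional X L a b (fun t => y t + (s * w t + r * eta t)))
    (delta_inner q (delta_deriv X w)) (delta_inner q (delta_deriv X eta)).
Proof.
move=> lL yC Ax wC wa wb etaC eta_a eta_b e e0.
have qc : rd_continuous X (kappa X) q by exact: reduced_momentum_rd_continuous.
have [M1 M10 w1] := antiderivative_bounded (C1rd_antiderivative wC).
have [M2 M20 w2] := rd_continuous_bounded wC.2.
have [M3 M30 eta1] := antiderivative_bounded (C1rd_antiderivative etaC).
have [M4 M40 eta2] := rd_continuous_bounded etaC.2.
pose K := M1 + M2 + M3 + M4 + 1.
have K0 : 0 < K by rewrite /K; lra.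
have eK : 0 < e / K by rewrite divr_gt0.
have [de de0 H] := functional_increment lL yC Ax eK.
exists (de / (2 * K)); first by rewrite divr_gt0//; lra.
move=> s r; rewrite !ltr_pdivlMr; try lra.
move=> sd rd.
have s0 := normr_ge0 s; have r0 := normr_ge0 r.
have comb u v : `|u| <= K -> `|v| <= K -> `|s * u + r * v| <= K * (`|s| + `|r|).
  move=> uK vK; apply: le_trans (ler_normD _ _) _; rewrite !normrM mulrDr.
  by rewrite [K * _]mulrC [K * `|r|]mulrC; apply: lerD; exact: ler_wpM2l.
have swC := C1rdZ s wC; have rnC := C1rdZ r etaC.
have hC := C1rdD swC rnC.
have h'E t : kappa X t -> delta_deriv X (fun t => s * w t + r * eta t) t
    = s * delta_deriv X w t + r * delta_deriv X eta t.
  by move=> kt; rewrite delta_derivD// !delta_derivZ.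
have := H _ (K * (`|s| + `|r|)) hC.
rewrite wa wb eta_a eta_b !mulr0 addr0 => /(_ erefl erefl).
have y0 : (fun t => y t + (0 * w t + 0 * eta t)) = y.
  by apply/funext => t; rewrite !mul0r !addr0.
have -> : e / K * (K * (`|s| + `|r|)) = e * (`|s| + `|r|) by field; lra.
rewrite y0 -/(delta_inner q _).
rewrite (delta_inner_linear (c := s) (d := r) wC.2 etaC.2 qc h'E).
apply.
- move=> t Xt; apply: comb; rewrite /K.
    by have := w1 t Xt; lra.
  by have := eta1 t Xt; lra.
- move=> t kt; rewrite h'E//; apply: comb; rewrite /K.
    by have := w2 t kt; lra.
  by have := eta2 t kt; lra.
- by rewrite mulrDr; lra.
Qed.

(** The expansion holds at every base point, in particular at each point of the
    line r |-> y + s w + r eta, where it implies continuity. *)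
Lemma functional_continuous_direction (L : R -> R -> R -> R) y w eta s :
  lagrangian X L -> C1rd X y ->
  C1rd X w -> w a = 0 -> w b = 0 -> C1rd X eta -> eta a = 0 -> eta b = 0 ->
  continuous (fun r : R =>
    functional X L a b (fun t => y t + (s * w t + r * eta t))).
Proof.
move=> lL yC wC wa wb etaC eta_a eta_b r0.
pose z t := y t + (s * w t + r0 * eta t).
have zC : C1rd X z.
  by apply: (C1rdD yC); apply: C1rdD; exact: C1rdZ.
have [_ zx _] := lL.2 z zC.
have [A Ax] := rd_continuous_antiderivative zx.
have [de de0 H] :=
  functional_expansion lL zC Ax wC wa wb etaC eta_a eta_b ltr01.
set D := delta_inner _ (delta_deriv X eta) in H.
have D0 := normr_ge0 D.
apply/cvgrPdist_lt => e e0.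
have k0 : 0 < Num.min de (e / (`|D| + 2)) by rewrite lt_min de0 divr_gt0//; lra.
apply/nbhs_ballP; exists (Num.min de (e / (`|D| + 2))) => //= r.
rewrite /ball/= distrC lt_min ltr_pdivlMr; last by lra.
move=> /andP[rde re].
have := H 0 (r - r0); rewrite normr0 => /(_ de0 rde).
have E u : (fun t => z t + (0 * w t + (u - r0) * eta t)) =
    (fun t => y t + (s * w t + u * eta t)).
  by apply/funext => t; rewrite /z; ring.
have E0 : (fun t => z t + (0 * w t + 0 * eta t)) = z.
  by apply/funext => t; ring.
rewrite E E0 mul0r !add0r mul1r -/z => h; rewrite distrC.
set u := functional _ _ _ _ _ in h *; set v := functional _ _ _ _ z in h *.
have -> : u - v = (u - v - (r - r0) * D) + (r - r0) * D by ring.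
apply: le_lt_trans (ler_normD _ _) _; rewrite normrM.
have := normr_ge0 (r - r0); nra.
Qed.

(** Source of variations: if f has integral zero, h vanishes at both ends. *)
Lemma C1rd_primitive f : rd_continuous X (kappa X) f ->
  exists h, [/\ C1rd X h, h a = 0, h b = delta_integral X f a b &
    forall t, kappa X t -> delta_deriv X h t = f t].
Proof.
move=> fc; have [F Ff] := rd_continuous_antiderivative fc.
have Ff' : antiderivative X f (fun t => F t + - F a).
  apply: (antiderivative_eq (f := fun t => f t + 0)).
    by move=> t _; exact: addr0.
  by apply: antiderivativeD => // t _; exact: has_delta_deriv_cst.
exists (fun t => F t + - F a); rewrite subrr (delta_integralE Ff)//; split=> //.
  exact: (antiderivative_C1rd fc).
by move=> t kt; apply: (delta_derivE kt); exact: Ff'.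
Qed.

Definition mean_free f t : R := f t - delta_integral X f a b / (b - a).

Lemma mean_free_rd_continuous f : rd_continuous X (kappa X) f ->
  rd_continuous X (kappa X) (mean_free f).
Proof. by move=> fc; apply: rd_continuousD => //; exact: rd_continuous_cst. Qed.

Lemma delta_integral_mean_free f : rd_continuous X (kappa X) f ->
  delta_integral X (mean_free f) a b = 0.
Proof.
move=> fc; set m := delta_integral X f a b.
rewrite (delta_integral_linear (c := 1) (d := - m / (b - a)) fc 
  (@rd_continuous_cst _ 1)).
  have -> : delta_integral X (fun=> 1) a b = b - a.
    by rewrite (delta_integralE (antiderivative_linear 1))// !mul1r.
  by rewrite -/m; field; rewrite subr_eq0 gt_eqF.
by move=> t _; rewrite /mean_free -/m; ring.
Qed.

(** Constants are orthogonal to functions of integral zero. *)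
Lemma delta_inner_mean_free f h : rd_continuous X (kappa X) f ->
  rd_continuous X (kappa X) h -> delta_integral X h a b = 0 ->
  delta_inner f h = delta_inner (mean_free f) h.
Proof.
move=> fc hc h0; have mc := mean_free_rd_continuous fc.
rewrite /delta_inner.
rewrite (delta_integral_linear (k := fun t => f t * h t) (c := 1)
  (d := delta_integral X f a b / (b - a)) (rd_continuousM mc hc) hc).
  by rewrite h0 mulr0 addr0 mul1r.
by move=> t _; rewrite /mean_free; ring.
Qed.

Lemma delta_inner_eqr f h k : rd_continuous X (kappa X) f ->
  rd_continuous X (kappa X) h -> (forall t, kappa X t -> k t = h t) ->
  delta_inner f k = delta_inner f h.
Proof.
move=> fc hc kh; rewrite (delta_inner_linear (c := 1) (d := 0) hc hc fc).
  by rewrite mul1r mul0r addr0.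
by move=> t kt; rewrite kh// mul1r mul0r addr0.
Qed.

(** * The isoperimetric problem *)

(** Projection of p_L on the orthogonal complement of p_g; see the introduction
    for the argument. *)
Lemma isoperimetric_du_bois_reymond (L g : R -> R -> R -> R) N y AL Ag
    (qL := reduced_momentum L AL y) (qg := reduced_momentum g Ag y) :
  is_C1rd_norm X N -> lagrangian X L -> lagrangian X g ->
  C1rd X y ->
  antiderivative X (along X (partial_x L) y) AL ->
  antiderivative X (along X (partial_x g) y) Ag ->
  local_minimum N [set z | [/\ C1rd X z, z a = y a, z b = y b &
      functional X g a b z = functional X g a b y]]
    (functional X L a b) y ->
  ~ (exists c, forall t, kappa X t -> qg t = c) ->
  exists lambda c, forall t, kappa X t -> qL t - lambda * qg t = c.
Proof.
move=> [N0 _ NZ ND] lL lg yC AxL Axg [_ [de de0 ymin]] qg_ncst.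
have qLc : rd_continuous X (kappa X) qL.
  exact: reduced_momentum_rd_continuous.
have qgc : rd_continuous X (kappa X) qg.
  exact: reduced_momentum_rd_continuous.
set pL := mean_free qL; set pg := mean_free qg.
have pLc : rd_continuous X (kappa X) pL by exact: mean_free_rd_continuous.
have pgc : rd_continuous X (kappa X) pg by exact: mean_free_rd_continuous.
have pL0 : delta_integral X pL a b = 0 by exact: delta_integral_mean_free.
have pg0 : delta_integral X pg a b = 0 by exact: delta_integral_mean_free.
have pgg : 0 < delta_inner pg pg.
  rewrite ltNge; apply/negP => /(delta_inner_sqr_le0 pgc) pgz.
  apply: qg_ncst; exists (delta_integral X qg a b / (b - a)) => t kt.
  by have := pgz t kt; rewrite /pg /mean_free => /eqP; rewrite subr_eq0 => /eqP.
(* The coefficient of the orthogonal projection of pL on the line of pg. *)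
pose lambda := delta_inner pg pL / delta_inner pg pg.
pose r t := 1 * pL t + - lambda * pg t.
have rc : rd_continuous X (kappa X) r.
  by apply: rd_continuousD; exact: rd_continuousZ.
have r0 : delta_integral X r a b = 0.
  rewrite (delta_integral_linear pLc pgc (fun t _ => erefl)).
  by rewrite pL0 pg0 !mulr0 addr0.
have rg : delta_inner pg r = 0.
  rewrite (delta_inner_linear pLc pgc pgc (fun t _ => erefl)) /lambda.
  by field; rewrite gt_eqF.
have rr : delta_inner r r = delta_inner pL r.
  rewrite [RHS]delta_innerC (delta_inner_linear pLc pgc rc (fun t _ => erefl)).
  by rewrite [delta_inner r pg]delta_innerC rg mulr0 addr0 mul1r.
suff rz : forall t, kappa X t -> r t = 0.
  exists lambda, ((delta_integral X qL a b
                   - lambda * delta_integral X qg a b) / (b - a)).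
  move=> t kt; apply/subr0_eq; rewrite -[RHS](rz t kt) /r /pL /pg /mean_free.
  by ring.
apply: (delta_inner_sqr_le0 rc); rewrite leNgt; apply/negP => rr0.
have [eta [etaC eta_a eta_b eta']] := C1rd_primitive pgc.
have [w [wC wa wb w']] := C1rd_primitive (rd_continuousZ (-1) rc).
rewrite pg0 in eta_b.
have rN0 : delta_integral X (fun t => -1 * r t) a b = 0.
  rewrite (delta_integral_linear (c := -1) (d := 0) rc rc) ?r0 ?mulr0 ?addr0//.
  by move=> t _; rewrite mul0r addr0.
rewrite rN0 in wb.
have Dw (q : R -> R) : rd_continuous X (kappa X) q ->
    delta_inner q (delta_deriv X w) = - delta_inner (mean_free q) r.
  move=> qc; rewrite (delta_inner_linear (c := -1) (d := 0) rc rc qc).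
    by rewrite mul0r addr0 mulN1r (delta_inner_mean_free qc rc r0).
  by move=> t kt; rewrite w'// mul0r addr0.
have Deta : delta_inner qg (delta_deriv X eta) = delta_inner pg pg.
  by rewrite (delta_inner_eqr qgc pgc eta') (delta_inner_mean_free qgc pgc pg0).
have EL := functional_expansion lL yC AxL wC wa wb etaC eta_a eta_b.
have Eg := functional_expansion lg yC Axg wC wa wb etaC eta_a eta_b.
rewrite -/qL (Dw qL qLc) -/pL -rr in EL.
rewrite -/qg (Dw qg qgc) -/pg rg oppr0 Deta in Eg.
have Cg s := functional_continuous_direction (s := s)
  lg yC wC wa wb etaC eta_a eta_b.
have NwC := N0 w wC; have NetaC := N0 eta etaC.
(* Within this bound on both coordinates, s w + u eta has norm below de. *)
have k0 : 0 < de / (N w + N eta + 1) by rewrite divr_gt0//; lra.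
have rrN : - delta_inner r r < 0 by rewrite oppr_lt0.
have [s [u [sk uk gE Llt]]] := constrained_descent EL Eg Cg rrN pgg k0.
have y0 : (fun t => y t + (0 * w t + 0 * eta t)) = y.
  by apply/funext => t; rewrite !mul0r !addr0.
rewrite y0 in gE Llt.
have swC := C1rdZ s wC; have unC := C1rdZ u etaC.
suff : functional X L a b y
    <= functional X L a b (fun t => y t + (s * w t + u * eta t)).
  by rewrite leNgt Llt.
apply: ymin.
  split=> //; first exact: (C1rdD yC (C1rdD swC unC)).
    by rewrite wa eta_a !mulr0 !addr0.
  by rewrite wb eta_b !mulr0 !addr0.
have -> : (fun t => y t + (s * w t + u * eta t) - y t)
    = (fun t => s * w t + u * eta t).
  by apply/funext => t; ring.
apply: le_lt_trans (ND _ _ swC unC) _; rewrite !NZ//.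
move: sk uk; rewrite !ltr_pdivlMr; try lra.
move=> sk uk; have := normr_ge0 s; have := normr_ge0 u.
have [su|us] := leP `|s| `|u|; nra.
Qed.

End CompactScale.

Lemma ts_interval_compact_scale (R : realType) (T : set R) (a b : R) :
  time_scale T -> T a -> T b -> a < b -> compact_scale (ts_interval T a b) a b.
Proof.
move=> [_ clT] Ta Tb ab; split=> //.
- have -> : ts_interval T a b = T `&` `[a, b]%classic.
    by apply/seteqP; split=> t; rewrite /= in_itv.
  by apply: closedI => //; exact: interval_closed.
- by split; rewrite // lexx ltW.
- by split; rewrite // lexx ltW.
- by move=> t [].
Qed.

Theorem theorem3p4 (R : realType) (T : set R) (a b ya yb l : R)
    (L g : R -> R -> R -> R) (N : (R -> R) -> R) (ystar : R -> R) :
  time_scale T -> T a -> T b -> a < b ->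
  let I_ab := ts_interval T a b in
  is_C1rd_norm I_ab N ->
  lagrangian I_ab L -> lagrangian I_ab g ->
  let J := functional I_ab L a b in
  let I := functional I_ab g a b in
  let S := [set y : R -> R |
              [/\ C1rd I_ab y, y a = ya, y b = yb & I y = l]] in
  local_minimum N S J ystar ->
  ~ extremal I_ab g a b ya yb l ystar ->
  exists lambda : R,
    let F := fun t x v : R => L t x v - lambda * g t x v in
    forall t : R, kappa (kappa I_ab) t ->
      exists2 d : R,
        has_delta_deriv_on I_ab (kappa I_ab)
          (along I_ab (partial_v F) ystar) t d &
        d - along I_ab (partial_x F) ystar t = 0.
Proof.
move=> Tts Ta Tb ab X normN lL lg J I S ymin nextr.
have cX : compact_scale X a b by exact: ts_interval_compact_scale.
have [_ Xa Xb _ _] := cX.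
have [yC ya' yb' yl] := ymin.1.
have [_ Lx _] := lL.2 _ yC; have [_ gx _] := lg.2 _ yC.
have [AL AxL] := rd_continuous_antiderivative cX Lx.
have [Ag Axg] := rd_continuous_antiderivative cX gx.
have [|[c hc]|lambda [c Ec]] :=
  isoperimetric_du_bois_reymond cX normN lL lg yC AxL Axg.
- by rewrite ya' yb' -/I yl.
- apply: nextr; split=> //; exists (c + Ag a) => t kt.
  rewrite (delta_integralE cX Axg Xa (kappa_sub kt)) -(hc t kt).
  by rewrite /reduced_momentum; ring.
exists lambda => F t /kappa_sub kt.
have [[Ldx Ldv _ _] _] := lL; have [[gdx gdv _ _] _] := lg.
have Fv s x v : kappa X s ->
    partial_v F s x v = partial_v L s x v - lambda * partial_v g s x v.
  move=> ks; rewrite /partial_v !derive1E.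
  have dg : derivable (lambda *: (fun v' => g s x v')) v 1.
    by apply: derivableZ; exact: gdv.
  by rewrite (deriveB (Ldv s x v ks) dg) deriveZ//; exact: gdv.
have Fx s x v : kappa X s ->
    partial_x F s x v = partial_x L s x v - lambda * partial_x g s x v.
  move=> ks; rewrite /partial_x !derive1E.
  have dg : derivable (lambda *: (fun x' => g s x' v)) x 1.
    by apply: derivableZ; exact: gdx.
  by rewrite (deriveB (Ldx s x v ks) dg) deriveZ//; exact: gdx.
exists (along X (partial_x F) ystar t); last exact: subrr.
exists (fun s => AL s + - lambda * Ag s + c); split.
  move=> s ks; rewrite /along Fv// -(Ec s ks).
  by rewrite /reduced_momentum /along; ring.
have -> : along X (partial_x F) ystar t
  = along X (partial_x L) ystar t
    + - lambda * along X (partial_x g) ystar t + 0.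
  by rewrite /along Fx//; ring.
apply: has_delta_derivD; last exact: has_delta_deriv_cst.
by apply: has_delta_derivD; [exact: AxL|apply: has_delta_derivZ; exact: Axg].
Qed.
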